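(* Let $M=\prod_{t\in T}M_t$ be a product of connected (finite-dimensional) manifolds, where $T$ has cardinality at most $2^{\aleph_0}$. Then every $f\in\mathcal C^\infty(M)$ is continuous (for the product topology) and countably cylindrical, i.e. there exist an at most countable subset $T_0\subset T$ and a $\mathcal C^\infty$ function $f_{T_0}:\prod_{t\in T_0}M_t\to\mathbb R$ such that $f=f_{T_0}\circ\pi_{T_0}$, where $\pi_{T_0}:M\to\prod_{t\in T_0}M_t$ is the coordinate projection.
   Context: The canonical $\mathcal C^\infty$ structure on a product $\prod_{t\in S}M_t$ of manifolds: its structure curves are the maps $c:\mathbb R\to\prod_tM_t$ whose components $c_t:\mathbb R\to M_t$ are all smooth, and its $\mathcal C^\infty$ functions are the $f:\prod_tM_t\to\mathbb R$ with $f\circ c\in C^\infty(\mathbb R,\mathbb R)$ for every structure curve $c$. *)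

(* Defs.v *)
From HB Require Import structures.
From mathcomp Require Import all_boot all_order all_algebra.
From mathcomp Require Import all_classical all_reals all_analysis.
Set Implicit Arguments. Unset Strict Implicit. Unset Printing Implicit Defensive.
Import Order.TTheory GRing.Theory Num.Theory.
Import numFieldNormedType.Exports.
Local Open Scope classical_set_scope.
Local Open Scope ring_scope.

Fixpoint Ck_on (R : realType) (V W : normedModType R) (k : nat)
    (A : set V) (f : V -> W) : Prop :=
  match k with
  | 0 => forall x, A x -> {for x, continuous f}
  | k'.+1 => (forall x, A x -> differentiable f x) /\
             (forall v : V, Ck_on k' A ('D_v f))
  end.

Definition smooth_on (R : realType) (V W : normedModType R)
    (A : set V) (f : V -> W) : Prop := forall k, Ck_on k A f.

Record atlas_on (R : realType) (X : topologicalType) := Atlas {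
  mdim : nat;
  m_charts : set (set X * (X -> 'rV[R]_mdim)) }.
Arguments m_charts {R X} a _.

Definition is_chart (R : realType) (X : topologicalType) (n : nat)
    (U : set X) (phi : X -> 'rV[R]_n) : Prop :=
  [/\ open U,
      {in U &, injective phi},
      {within U, continuous phi} &
      forall V, open V -> V `<=` U -> open (phi @` V)].

(** X with the atlas A is a (finite-dimensional, smooth) manifold:
    Hausdorff, second countable, covered by pairwise smoothly compatible
    m_charts (the smooth structure is the maximal atlas generated by A). *)
Definition is_manifold (R : realType) (X : topologicalType)
    (A : atlas_on R X) : Prop :=
  [/\ hausdorff_space X,
      @second_countable X,
      (forall c, m_charts A c -> is_chart c.1 c.2),
      (forall x : X, exists2 c, m_charts A c & c.1 x) &
      (forall c d, m_charts A c -> m_charts A d ->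
        exists g : 'rV[R]_(mdim A) -> 'rV[R]_(mdim A),
          smooth_on (c.2 @` (c.1 `&` d.1)) g /\
          forall x, c.1 x -> d.1 x -> g (c.2 x) = d.2 x)].

Definition smooth_curve (R : realType) (X : topologicalType)
    (A : atlas_on R X) (c : R -> X) : Prop :=
  continuous c /\
  forall U phi, m_charts A (U, phi) -> smooth_on (c @^-1` U) (phi \o c).

Definition structure_curve (R : realType) (I : Type)
    (M : I -> topologicalType) (A : forall i, atlas_on R (M i))
    (c : R -> prod_topology M) : Prop :=
  forall i, smooth_curve (A i) (fun s => c s i).

Definition Cinf_prod (R : realType) (I : Type)
    (M : I -> topologicalType) (A : forall i, atlas_on R (M i))
    (f : prod_topology M -> R) : Prop :=
  forall c, structure_curve A c -> smooth_on setT (f \o c).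

Definition restr_fam (I : Type) (T0 : set I) (M : I -> topologicalType) :
  {t : I | T0 t} -> topologicalType := fun i => M (proj1_sig i).
Arguments restr_fam {I} T0 M _.

Definition restr_atlas (R : realType) (I : Type) (T0 : set I)
    (M : I -> topologicalType) (A : forall i, atlas_on R (M i)) :
  forall i : {t : I | T0 t}, atlas_on R (restr_fam T0 M i) :=
  fun i => A (proj1_sig i).
Arguments restr_atlas {R I} T0 {M} A _.

Definition proj_sub (I : Type) (T0 : set I) (M : I -> topologicalType)
    (x : prod_topology M) : prod_topology (restr_fam T0 M) :=
  fun i => x (proj1_sig i).
Arguments proj_sub {I} T0 {M} x _.

(* Main.v *)
Require Import Defs.
From HB Require Import structures.
From mathcomp Require Import all_boot all_order all_algebra.
From mathcomp Require Import all_classical all_reals all_analysis.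
From mathcomp Require Import ring lra.
Import Order.TTheory GRing.Theory Num.Theory.
Import numFieldNormedType.Exports.
Local Open Scope classical_set_scope.
Local Open Scope ring_scope.

Set Implicit Arguments.
Unset Strict Implicit.
Unset Printing Implicit Defensive.

(** If [y n] and [x] are points of the product such that in every coordinate
    [y n t = x t] for large [n], or [y n t] tends to [x t] rapidly in a chart,
    then for any times [s n] decreasing at least geometrically to [0] a
    structure curve passes through [y n] at time [s n] and through [x] at time
    [0]: the n-th excursion from [x t] to [y n t] and back is squeezed into
    [[s n / 2, 3 s n / 2]].

    In the first case [f (y n) - f x = O(s n)] for every choice of [s], so that
    [f (y n) = f x] for some [n]. Since the index set embeds in the Cantor
    space, bisection turns any [y] with [f y <> f x] into one which moreover
    differs from [x] at finitely many coordinates only, and a sequence of such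
    points with disjoint supports is excluded; hence a finite set [F x] of
    coordinates determines [f] at [x], i.e. [f y = f x] if [y = x] on [F x].
    Given this, a discontinuity of [f] at [x] is witnessed by points which
    converge to [x] in the second sense, and which a curve would join.
    Finally the product is separable, and [f] depends only on the
    coordinates in the union of the [F d] for [d] in a countable dense set. *)

(** * Calculus of curves *)

Section Ck_calculus.
Variable R : realType.
Implicit Types (V W : normedModType R) (B : set R).

Lemma Ck_on_sub V W k (A B : set V) (f : V -> W) :
  A `<=` B -> Ck_on k B f -> Ck_on k A f.
Proof.
move=> AB; elim: k f => [|k IH] f /=; first by move=> h x /AB; exact: h.
by move=> [df Df]; split=> [x /AB|v]; [exact: df|exact/IH/Df].
Qed.

Lemma Ck_on_local V W k (A : set V) (f : V -> W) :
  (forall x, A x -> exists2 B, B x & Ck_on k B f) -> Ck_on k A f.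
Proof.
elim: k f => [|k IH] f /= h; first by move=> x /h[B Bx]; exact.
split=> [x /h[B Bx [+ _]]|v]; first exact.
by apply: IH => x /h[B Bx [_ df]]; exists B.
Qed.

Lemma Ck_onW V W k (A : set V) (f : V -> W) : Ck_on k.+1 A f -> Ck_on k A f.
Proof.
elim: k f => [|k IH] f [df Df].
  by move=> x Ax; exact/differentiable_continuous/df.
by split=> // v; exact/IH/Df.
Qed.

Lemma Ck_on_ext W k B (f g : R -> W) :
  open B -> (forall x, B x -> f x = g x) -> Ck_on k B f -> Ck_on k B g.
Proof.
move=> oB; elim: k f g => [|k IH] f g fg.
  move=> cf x Bx; have fgx : \forall y \near x, f y = g y.
    by near=> y; apply: fg; near: y; exact: open_nbhs_nbhs.
  suff : g @ x --> g x by [].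
  rewrite -(fg x Bx); apply: cvg_trans (cf _ Bx); exact: near_eq_cvg.
have fgx x : B x -> \forall y \near x, f y = g y.
  by move=> Bx; near=> y; apply: fg; near: y; exact: open_nbhs_nbhs.
move=> [df Df]; split=> [x Bx|v].
  apply/derivable1_diffP/(@near_eq_derivable _ _ _ f); first exact: fgx.
  exact/derivable1_diffP/df.
by apply: IH (Df v) => x Bx; exact/near_eq_derive/fgx.
Unshelve. all: by end_near. Qed.

Lemma Ck_on_cst V W k (A : set V) (w : W) : Ck_on k A (fun=> w).
Proof.
elim: k w => [|k IH] w; first by move=> x _; exact: cst_continuous.
split=> [x _|v]; first exact: differentiable_cst.
by rewrite (_ : 'D_v _ = fun=> 0)//; apply/funext => x; exact: derive_cst.
Qed.

Lemma Ck_on_add W k B (f g : R -> W) : open B ->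
  Ck_on k B f -> Ck_on k B g -> Ck_on k B (fun x => f x + g x).
Proof.
move=> oB; elim: k f g => [|k IH] f g.
  by move=> cf cg x Bx; apply: continuousD; [exact: cf|exact: cg].
move=> [df Df] [dg Dg]; split=> [x Bx|v].
  by apply: differentiableD; [exact: df|exact: dg].
apply: (@Ck_on_ext _ _ _ (fun x => 'D_v f x + 'D_v g x)) => //;
  last exact: IH (Df v) (Dg v).
move=> x Bx; have dfx := diff_derivable (v := v) (df _ Bx).
by have dgx := diff_derivable (v := v) (dg _ Bx); rewrite -deriveD.
Qed.

Lemma is_derive_scale W (a : R -> R) (u : R -> W) x v :
  derivable a x v -> derivable u x v ->
  is_derive x v (fun y => a y *: u y) (a x *: 'D_v u x + 'D_v a x *: u x).
Proof.
move=> da du; have cu : (fun h : R => u (h *: v + x)) @ 0 --> u (0 *: v + x).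
  move/derivable1P/derivable1_diffP/differentiable_continuous: du.
  exact.
pose q h := h^-1 *: (((fun y => a y *: u y) \o shift x) (h *: v) - a x *: u x).
suff H : q @ 0^' --> a x *: 'D_v u x + 'D_v a x *: u x.
  by split; [exact: cvgP H|exact: cvg_lim H].
(* The quotient splits into a term with [a x] frozen and a term with [u] at the moved point;
   continuity of [u] handles the latter. *)
have -> : q =
   (fun h => a x *: (h^-1 *: ((u \o shift x) (h *: v) - u x)) +
     (h^-1 *: ((a \o shift x) (h *: v) - a x)) *: u (h *: v + x)).
  apply/funext => h; rewrite /q /=.
  rewrite scalerA [a x * _]mulrC -scalerA.
  rewrite -[(h^-1 *: (_ - a x)) *: _]scalerA -scalerDr; congr (_ *: _).
  by rewrite scalerBr scalerBl [RHS]addrC addrA subrK.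
apply: cvgD; first by apply: cvgZl_tmp; exact: du.
apply: cvgZ; first exact: da.
rewrite scale0r add0r in cu; apply: cvg_trans cu; exact/cvg_app/nbhs_dnbhs.
Qed.

Lemma Ck_on_scale W k B (a : R -> R) (u : R -> W) : open B ->
  Ck_on k B a -> Ck_on k B u -> Ck_on k B (fun x => a x *: u x).
Proof.
move=> oB; elim: k a u => [|k IH] a u.
  by move=> ca cu x Bx; apply: continuousZ; [exact: ca|exact: cu].
move=> Ca Cu; have [[da Da] [du Du]] := (Ca, Cu).
have dd x v : B x -> is_derive x v (fun y => a y *: u y)
    (a x *: 'D_v u x + 'D_v a x *: u x).
  by move=> Bx; apply: is_derive_scale; apply: diff_derivable;
    [exact: da|exact: du].
split=> [x Bx|v]; first by apply/derivable1_diffP; have [] := dd x 1 Bx.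
apply: (@Ck_on_ext _ _ _ (fun x => a x *: 'D_v u x + 'D_v a x *: u x)) => //.
  by move=> x Bx; have [] := dd x v Bx.
apply: Ck_on_add => //; first exact: IH (Ck_onW Ca) (Du v).
exact: IH (Da v) (Ck_onW Cu).
Qed.

Lemma Ck_on_linear W W' k B (l : {linear W -> W'}) (u : R -> W) :
  continuous l -> open B -> Ck_on k B u -> Ck_on k B (l \o u).
Proof.
move=> cl oB; elim: k u => [|k IH] u.
  by move=> cu x Bx; apply: continuous_comp; [exact: cu|exact: cl].
move=> [du Du]; have dl y : differentiable l y by exact: linear_differentiable.
split=> [x Bx|v]; first by apply: differentiable_comp; [exact: du|].
apply: (@Ck_on_ext _ _ _ (l \o 'D_v u)) => //; last exact: IH (Du v).
move=> x Bx; rewrite (deriveE _ (differentiable_comp (du x Bx) (dl _))).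
by rewrite diff_comp//=; [rewrite diff_lin// deriveE//; exact: du|exact: du].
Qed.

(** On the line ['D_v f] is [v] times ['D_1 f], so the recursion over all directions reduces to the
    direction 1. *)
Lemma Ck_onS1 W k B (f : R -> W) : open B ->
  (forall x, B x -> derivable f x 1) -> Ck_on k B ('D_1 f) -> Ck_on k.+1 B f.
Proof.
move=> oB df Df; have df' x : B x -> differentiable f x.
  by move=> Bx; exact/derivable1_diffP/df.
split=> // v; apply: (@Ck_on_ext _ _ _ (fun x => v *: 'D_1 f x)) => //.
  move=> x Bx; rewrite !deriveE; [|exact: df'..].
  by rewrite -linearZ/= [v%:A]mulr1.
by apply: Ck_on_scale => //; exact: Ck_on_cst.
Qed.

Lemma Ck_on_id k B : open B -> Ck_on k B (fun x : R => x).
Proof.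
case: k => [|k] oB; first by move=> x _; exact: cvg_id.
apply: Ck_onS1 => //.
have /funext -> : 'D_(1 : R) (fun x : R => x) =1 fun=> (1 : R).
  by move=> x; exact: derive_id.
exact: Ck_on_cst.
Qed.

Lemma Ck_on_sum W k B n (f : 'I_n -> R -> W) : open B ->
  (forall i, Ck_on k B (f i)) -> Ck_on k B (fun x => \sum_(i < n) f i x).
Proof.
move=> oB h; elim: n f h => [|n IH] f h.
  by rewrite (_ : (fun _ => _) = fun=> 0);
    [exact: Ck_on_cst|apply/funext => x; rewrite big_ord0].
rewrite (_ : (fun _ => _) =
   fun x => \sum_(i < n) f (widen_ord (leqnSn n) i) x + f ord_max x).
  by apply: Ck_on_add => //; exact: IH.
by apply/funext => x; rewrite big_ord_recr.
Qed.

(* The coordinate system turns D_v (g o u) into the combination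
   sum_i xi_i (D_v u) *: (D_(e_i) g o u) of derivatives of g along constant
   vectors, to which the induction applies. *)
Lemma Ck_on_comp V W n (e : 'I_n -> V) (xi : 'I_n -> {linear V -> R^o})
  k (A : set V) B (g : V -> W) (u : R -> V) :
  (forall v, v = \sum_(i < n) xi i v *: e i) -> (forall i, continuous (xi i)) ->
  open B -> (forall x, B x -> A (u x)) ->
  Ck_on k A g -> Ck_on k B u -> Ck_on k B (g \o u).
Proof.
move=> xiE cxi oB BA; elim: k g u BA => [|k IH] g u BA.
  by move=> cg cu x Bx; apply: continuous_comp; [exact: cu|exact/cg/BA].
move=> [dg Dg] Cu; have [du Du] := Cu.
split=> [x Bx|v]; first by apply: differentiable_comp; [exact: du|exact/dg/BA].
apply: (@Ck_on_ext _ _ _ (fun x => \sum_(i < n)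
   (xi i ('D_v u x) : R) *: ('D_(e i) g \o u) x)) => //.
  move=> x Bx; have dux := du x Bx; have dgx := dg _ (BA _ Bx).
  rewrite (deriveE _ (differentiable_comp dux dgx)) diff_comp//= -(deriveE _ dux).
  rewrite [in RHS](xiE ('D_v u x)) linear_sum/=; apply: eq_bigr => i _.
  by rewrite linearZ/= -deriveE.
apply: Ck_on_sum => // i; apply: Ck_on_scale => //.
  exact: (Ck_on_linear (cxi i) oB (Du v)).
exact: IH (Dg _) (Ck_onW Cu).
Qed.

Lemma Ck_on_comp_rV W n k (A : set 'rV[R]_n) B (g : 'rV[R]_n -> W)
  (u : R -> 'rV[R]_n) : open B -> (forall x, B x -> A (u x)) ->
  Ck_on k A g -> Ck_on k B u -> Ck_on k B (g \o u).
Proof.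
pose c i (v : 'rV[R]_n) : R^o := v 0 i.
have lin i : linear (c i) by move=> a x y; rewrite /c !mxE.
pose l i : {linear 'rV[R]_n -> R^o} :=
  HB.pack (c i) (GRing.isLinear.Build _ _ _ _ _ (lin i)).
apply: (@Ck_on_comp _ _ n (delta_mx 0) l) => [v|i].
  exact: row_sum_delta.
exact: coord_continuous.
Qed.

Lemma Ck_on_comp_R W k (A : set R) B (g : R -> W) (u : R -> R) :
  open B -> (forall x, B x -> A (u x)) ->
  Ck_on k A g -> Ck_on k B u -> Ck_on k B (g \o u).
Proof.
apply: (@Ck_on_comp R W 1 (fun=> 1) (fun=> idfun)) => [v|i].
  by rewrite big_ord1 [_ *: _]mulr1.
by move=> x; exact: cvg_id.
Qed.

End Ck_calculus.

(** * A smooth plateau function *)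

Section Plateau.
Variable R : realType.
Implicit Types (W : normedModType R).

(** The difference quotient at 0 is at most [|C| |h|]. This settles the delicate point 0 both for
    [flat_exp] and for [pulses]. *)
Lemma is_derive_flat W (f : R -> W) (C : R) : f 0 = 0 ->
  (\forall x \near (0 : R), `|f x| <= C * x ^+ 2) -> is_derive (0 : R) (1 : R) f 0.
Proof.
move=> f0 fC.
suff H : (fun h => h^-1 *: ((f \o shift (0 : R)) (h *: (1 : R)) - f 0)) @ 0^'
    --> (0 : W).
  by split; [exact: cvgP H|exact: cvg_lim H].
apply/cvgr0Pnorm_lt => e e0.
have eC : 0 < e / (`|C| + 1) by rewrite divr_gt0// ltr_wpDl.
near=> h; rewrite /= f0 subr0 addr0 [h *: 1]mulr1 normrZ normfV.
have h0 : h != 0 by near: h; exact: nbhs_dnbhs_neq.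
rewrite ltr_pdivrMl ?normr_gt0//.
have hC : `|f h| <= C * h ^+ 2 by near: h; exact: nbhs_dnbhs.
apply: le_lt_trans hC _; rewrite -(ger0_norm (sqr_ge0 h)) normrX.
have he : `|h| < e / (`|C| + 1) by near: h; exact: dnbhs0_lt.
apply: (@le_lt_trans _ _ ((`|C| + 1) * `|h| ^+ 2)).
  by apply: ler_wpM2r; [exact: exprn_ge0|rewrite (le_trans (ler_norm C))// lerDl].
rewrite expr2 mulrCA ltr_pM2l ?normr_gt0// -ltr_pdivlMl ?[_^-1 * _]mulrC//.
Unshelve. all: by end_near. Qed.

(** The factor [x^-m] makes the family closed, up to linear combinations, under differentiation, so
    that smoothness follows by one induction for all m. *)
Definition flat_exp m (x : R) : R :=
  if 0 < x then x^-1 ^+ m * expR (- x^-1) else 0.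

Lemma flat_exp_ge0 m x : 0 <= flat_exp m x.
Proof.
rewrite /flat_exp; case: ifPn => // x0.
by rewrite mulr_ge0 ?expR_ge0// exprn_ge0// invr_ge0 ltW.
Qed.

(** With [u = x^-1], the exponential series gives [u ^ (m+2) / (m+2)! <= exp u]. *)
Lemma flat_exp_le m x : flat_exp m x <= (m.+2)`!%:R * x ^+ 2.
Proof.
rewrite /flat_exp; case: ifPn => x0; last by rewrite mulr_ge0// sqr_ge0.
have u0 : 0 < x^-1 by rewrite invr_gt0.
have := expR_ge1Dxn m.+1 (ltW u0); set F := (_`!%:R : R) => h.
have F0 : 0 < F by rewrite ltr0n fact_gt0.
have {}h : x^-1 ^+ m.+2 / F <= expR x^-1 by apply: le_trans h; rewrite lerDr.
rewrite expRN ler_pdivrMr ?expR_gt0//.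
apply: le_trans (ler_wpM2l _ h); last by rewrite mulr_ge0 ?sqr_ge0// ltW.
rewrite [_ ^+ m.+2]exprS [_ ^+ m.+1]exprS; set p := x^-1 ^+ m.
rewrite [leRHS](_ : _ = p)//.
by field; rewrite !gt_eqF.
Qed.

Lemma is_derive_flat_exp m (x : R) : is_derive x 1 (flat_exp m)
  (- m%:R * flat_exp m.+1 x + flat_exp m.+2 x).
Proof.
have [x0|x0|<-] := ltrgtP 0 x.
- have nx0 : x != 0 by rewrite gt_eqF.
  apply: (@near_eq_is_derive _ _ _ (fun y : R => y^-1 ^+ m * expR (- y^-1))).
    near=> y; rewrite /flat_exp ifT//; near: y; exact: lt_nbhsr.
  have dV : is_derive x 1 (fun y : R => y^-1) (- x ^- 2 *: 1).
    by apply: is_deriveV => //; exact: is_derive_id.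
  have dE : is_derive x 1 (expR \o (fun y => - y^-1))
      (expR (- x^-1) * - (- x ^- 2 *: 1)).
    by apply: is_derive1_comp; exact: is_deriveN.
  have H := is_deriveM (is_deriveX m dV) dE.
  have -> : (fun y : R => y^-1 ^+ m * expR (- y^-1)) =
      ([eta GRing.inv] ^+ m * (expR \o (fun y : R => - y^-1))).
    by apply/funext => y; rewrite !fctE.
  apply: (is_derive_eq H).
  rewrite /flat_exp x0 /= !exprfctE.
  rewrite /GRing.scale/= !mulr1; clear H; case: m => [|m] /=.
    by rewrite expr0 expr1; field; rewrite !gt_eqF.
  rewrite !(exprS x^-1) -!exprVn; set p := x^-1 ^+ m; set E := expR _.
  by move: (m.+1%:R : R) => c; ring.
- apply: (@near_eq_is_derive _ _ _ (fun=> 0)).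
    by near=> y; rewrite /flat_exp ifN// -leNgt ltW//; near: y; exact: lt_nbhsl.
  by rewrite /flat_exp ltNge (ltW x0)/= mulr0 addr0; exact: is_derive_cst.
- rewrite /flat_exp ltxx mulr0 addr0; apply: (@is_derive_flat _ _ (m.+2)`!%:R).
    by rewrite /flat_exp ltxx.
  by near=> y; rewrite ger0_norm ?flat_exp_ge0// flat_exp_le.
Unshelve. all: by end_near. Qed.

Lemma Ck_flat_exp k m : Ck_on k setT (flat_exp m).
Proof.
elim: k m => [|k IH] m.
  move=> x _; apply/differentiable_continuous/derivable1_diffP.
  by have [] := is_derive_flat_exp m x.
apply: Ck_onS1 => [|x _|]; first exact: openT.
  by have [] := is_derive_flat_exp m x.
apply: (@Ck_on_ext _ _ _ _ (fun x => - m%:R *: flat_exp m.+1 x + flat_exp m.+2 x)).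
- exact: openT.
- by move=> x _; have [_ ->] := is_derive_flat_exp m x.
- apply: Ck_on_add => //; first exact: openT.
  by apply: Ck_on_scale; [exact: openT|exact: Ck_on_cst|exact: IH].
Qed.

Lemma flat_exp_le_mono x y : x <= y -> flat_exp 0 x <= flat_exp 0 y.
Proof.
rewrite /flat_exp; case: ifPn => x0 xy; last first.
  by case: ifPn => // y0; rewrite mul1r expR_ge0.
have y0 := lt_le_trans x0 xy; rewrite y0 !mul1r ler_expR lerN2.
by rewrite lef_pV2.
Qed.

(* The outer flat_exp vanishes where s (1 - s) >= 3 / 16: there plateau s = 1. *)
Definition plateau (s : R) : R :=
  1 - (flat_exp 0 (flat_exp 0 (3 / 16)))^-1 *
      flat_exp 0 (flat_exp 0 (3 / 16) - flat_exp 0 (s * (1 - s))).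

Lemma flat_exp_gt0 x : 0 < x -> 0 < flat_exp 0 x.
Proof. by move=> x0; rewrite /flat_exp x0 mul1r expR_gt0. Qed.

Lemma flat_exp_eq0 x : x <= 0 -> flat_exp 0 x = 0.
Proof. by move=> x0; rewrite /flat_exp ltNge x0. Qed.

Let a_gt0 : 0 < flat_exp 0 (flat_exp 0 (3 / 16)).
Proof. by do 2 apply: flat_exp_gt0; rewrite divr_gt0. Qed.

Lemma plateau_ge0 s : 0 <= plateau s.
Proof.
rewrite /plateau subr_ge0 ler_pdivrMl// mulr1.
by apply: flat_exp_le_mono; rewrite gerBl flat_exp_ge0.
Qed.

Lemma plateau_le1 s : plateau s <= 1.
Proof. by rewrite /plateau gerBl mulr_ge0 ?flat_exp_ge0// invr_ge0 ltW. Qed.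

Lemma plateau_out s : ~~ (0 < s < 1) -> plateau s = 0.
Proof.
move=> h; rewrite /plateau (@flat_exp_eq0 (s * _)) ?subr0; last first.
  by move: h; rewrite negb_and -!leNgt => /orP[] h; nra.
by rewrite mulVf ?subrr// gt_eqF.
Qed.

Lemma plateau_in s : `|s - 1 / 2| <= 1 / 4 -> plateau s = 1.
Proof.
rewrite ler_norml => /andP[h1 h2].
rewrite /plateau (@flat_exp_eq0 (_ - _)) ?mulr0 ?subr0// subr_le0.
by apply: flat_exp_le_mono; nra.
Qed.

Lemma Ck_plateau k : Ck_on k setT plateau.
Proof.
have oT := @openT R.
have C1 : Ck_on k setT (fun s : R => s *: (1 + (-1 : R) *: s)).
  apply: Ck_on_scale => //; first exact: Ck_on_id.
  apply: Ck_on_add => //; first exact: Ck_on_cst.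
  by apply: Ck_on_scale => //; [exact: Ck_on_cst|exact: Ck_on_id].
have C2 := Ck_on_comp_R oT (fun _ _ => I) (@Ck_flat_exp k 0) C1.
pose a := flat_exp 0 (3 / 16).
have C3 : Ck_on k setT (fun s : R =>
    a + (-1 : R) *: flat_exp 0 (s *: (1 + (-1 : R) *: s))).
  apply: Ck_on_add => //; first exact: Ck_on_cst.
  by apply: Ck_on_scale => //; exact: Ck_on_cst.
have C4 := Ck_on_comp_R oT (fun _ _ => I) (@Ck_flat_exp k 0) C3.
have : Ck_on k setT (fun s : R => 1 + (- (flat_exp 0 a)^-1) *:
    flat_exp 0 (a + (-1 : R) *: flat_exp 0 (s *: (1 + (-1 : R) *: s)))).
  apply: Ck_on_add => //; first exact: Ck_on_cst.
  by apply: Ck_on_scale => //; exact: Ck_on_cst.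
apply: Ck_on_ext => // s _.
by rewrite /plateau /GRing.scale/= !mulN1r mulNr.
Qed.

End Plateau.

(** * Smooth curves in a manifold *)

Section Local_smoothness.
Variables (R : realType) (X : topologicalType) (A : atlas_on R X).
Hypothesis hM : is_manifold A.

(** One chart around [c s] suffices and continuity is a consequence, which makes glued curves easy
    to check; [lsmooth_curve] passes to all charts through the transition maps. *)
Definition lsmooth (c : R -> X) (s : R) :=
  exists U phi, m_charts A (U, phi) /\
    exists B : set R, [/\ open B, B s, (forall y, B y -> U (c y)) &
      smooth_on B (phi \o c)].

Lemma chart_is_chart U phi : m_charts A (U, phi) -> is_chart U phi.
Proof. by have [_ _ h _ _] := hM => /h. Qed.

Lemma chart_at x : exists U phi, m_charts A (U, phi) /\ U x.
Proof. by have [_ _ _ h _] := hM; have [[U phi] ? ?] := h x; exists U, phi. Qed.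

(** A chart is injective and open, so a neighbourhood of [c s] can be tested on its image under
    [phi]. *)
Lemma lsmooth_continuous c s : lsmooth c s -> c @ s --> c s.
Proof.
move=> [U [phi [/chart_is_chart[oU injphi _ openphi] [B [oB Bs BU sB]]]]] N.
rewrite nbhsE; case=> O [oO Oc] ON.
have : open (phi @` (O `&` U)) by apply: openphi; [exact: openI|move=> ? []].
have cc : (phi \o c) @ s --> (phi \o c) s by exact: (sB 0).
move=> oW; have Ws : (phi @` (O `&` U)) ((phi \o c) s).
  by exists (c s) => //; split=> //; exact: BU.
have {}cc := cc _ (open_nbhs_nbhs (conj oW Ws)).
suff : \forall y \near s, N (c y) by [].
near=> y; apply: ON; have [z [Oz Uz] pzy] : (phi @` (O `&` U)) (phi (c y)).
  by near: y; exact: cc.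
have By : B y by near: y; exact: open_nbhs_nbhs.
by rewrite -(injphi _ _ _ _ pzy) ?inE//; exact: BU.
Unshelve. all: by end_near. Qed.

Lemma lsmooth_curve c : (forall s, lsmooth c s) -> smooth_curve A c.
Proof.
move=> h; have cc : continuous c by move=> s; exact: lsmooth_continuous.
split=> // V psi hV k; apply: Ck_on_local => s Vs.
have [U [phi [hU [B [oB Bs BU sB]]]]] := h s.
have [_ _ _ _ /(_ _ _ hU hV)[/= g [sg gE]]] := hM.
have [oV _ _ _] := chart_is_chart hV.
have oB' : open (B `&` c @^-1` V).
  by apply: openI => //; apply: open_comp => // ? _; exact: cc.
exists (B `&` c @^-1` V) => //.
apply: (@Ck_on_ext _ _ _ _ (g \o (phi \o c))) => //.
  by move=> y [By Vy] /=; apply: gE => //; exact: BU.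
apply: Ck_on_comp_rV (sg k) _ => //; last by apply: Ck_on_sub (sB k) => ? [].
by move=> y [By Vy]; exists (c y) => //; split=> //; exact: BU.
Qed.

Lemma lsmooth_near c d s : {near s, c =1 d} -> lsmooth c s -> lsmooth d s.
Proof.
rewrite /prop_near1 nbhsE; case=> O [oO Os] Ocd.
move=> [U [phi [hU [B [oB Bs BU sB]]]]].
exists U, phi; split=> //; exists (O `&` B); split=> //.
- exact: openI.
- by move=> y [/Ocd/= <-]; exact: BU.
- move=> k; apply: (@Ck_on_ext _ _ _ _ (phi \o c)); first exact: openI.
    by move=> y [/Ocd/= -> _].
  by apply: Ck_on_sub (sB k) => ? [].
Qed.

Lemma lsmooth_comp c (u : R -> R) s :
  smooth_on setT u -> lsmooth c (u s) -> lsmooth (c \o u) s.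
Proof.
move=> su [U [phi [hU [B [oB Bs BU sB]]]]].
have oB' : open (u @^-1` B) by apply: open_comp => // x _; exact: (su 0).
exists U, phi; split=> //; exists (u @^-1` B); split=> //.
  by move=> y; exact: BU.
move=> k; apply: (@Ck_on_comp_R _ _ _ B _ (phi \o c)) => //.
by apply: Ck_on_sub (su k).
Qed.

Lemma lsmooth_cst x s : lsmooth (fun=> x) s.
Proof.
have [U [phi [hU Us]]] := chart_at x; exists U, phi; split=> //.
by exists setT; split=> //; [exact: openT|move=> k; exact: Ck_on_cst].
Qed.

Lemma lsmooth_chart U phi (c : R -> X) (g : R -> 'rV[R]_(mdim A)) B s :
  m_charts A (U, phi) -> open B -> B s -> smooth_on B g ->
  (forall y, B y -> U (c y) /\ phi (c y) = g y) -> lsmooth c s.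
Proof.
move=> hU oB Bs sg cg; exists U, phi; split=> //; exists B; split=> //.
  by move=> y /cg[].
by move=> k; apply: Ck_on_ext (sg k) => // y /cg[_ <-].
Qed.

End Local_smoothness.

(** * Excursions from a point and back, and their concatenation *)

Section Excursions.
Variables (R : realType) (X : topologicalType) (A : atlas_on R X).

Lemma Ck_affine k (a b : R) : Ck_on k setT (fun s : R => a * s + b).
Proof.
apply: Ck_on_add; [exact: openT| |exact: Ck_on_cst].
apply: (@Ck_on_scale _ R^o _ _ (fun=> a) id); first exact: openT.
  exact: Ck_on_cst.
by apply: Ck_on_id; exact: openT.
Qed.

(** The curve rests at y on a whole interval around 1/2, which leaves room for inserting a further
    excursion from y. *)
Definition excursion (x y : X) (c : R -> X) :=
  [/\ forall s, lsmooth A c s, forall s, ~~ (0 < s < 1) -> c s = x &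
      exists2 d : R, 0 < d <= 1 / 2 & forall s, `|s - 1 / 2| < d -> c s = y].

Lemma excursion_trans x y z c d : excursion x y c -> excursion y z d ->
  exists c', excursion x z c'.
Proof.
move=> [sc cx [e /andP[e0 e1] cy]] [sd dy [e' /andP[e'0 e'1] dz]].
(* While [c] rests at y, [d] is run at speed [1/e]: [u] stretches [|s - 1/2| < e/2] onto (0, 1). For
   [e/2 < |s - 1/2| < e] both [c] and [d \o u] equal y, so the pieces fit together smoothly. *)
pose u (s : R) := e^-1 * s + (1 / 2 - e^-1 / 2).
have uE s : u s - 1 / 2 = e^-1 * (s - 1 / 2) by rewrite /u; field; rewrite gt_eqF.
have unorm s : `|u s - 1 / 2| = e^-1 * `|s - 1 / 2|.
  by rewrite uE normrM gtr0_norm// invr_gt0.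
pose c' s := if `|s - 1 / 2| < e then d (u s) else c s.
have nbl (r s : R) : `|s - 1 / 2| < r -> \forall t \near s, `|t - 1 / 2| < r.
  have ct : (fun t : R => `|t - 1 / 2|) @ s --> `|s - 1 / 2|.
    by apply: cvg_norm; apply: cvgB; [exact: cvg_id|exact: cvg_cst].
  by move=> h; exact: (cvgr_lt _ ct).
have nbg (r s : R) : r < `|s - 1 / 2| -> \forall t \near s, r < `|t - 1 / 2|.
  have ct : (fun t : R => `|t - 1 / 2|) @ s --> `|s - 1 / 2|.
    by apply: cvg_norm; apply: cvgB; [exact: cvg_id|exact: cvg_cst].
  by move=> h; exact: (cvgr_gt _ ct).
have out (s : R) : e / 2 < `|s - 1 / 2| -> ~~ (0 < u s < 1).
  move=> h; have : 1 / 2 < `|u s - 1 / 2|.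
    by rewrite unorm ltr_pdivlMl//; lra.
  rewrite negb_and -!leNgt; case: (leP (u s) 0) => //= u0.
  by rewrite ltr_normr => /orP[]; lra.
exists c'; split.
- move=> s; have [h|h] := ltP `|s - 1 / 2| e.
    apply: (@lsmooth_near _ _ _ (d \o u)).
      by near=> t; rewrite /c' ifT//; near: t; exact: nbl.
    by apply: lsmooth_comp => // k; exact: Ck_affine.
  apply: (@lsmooth_near _ _ _ c) => //.
  near=> t; rewrite /c'; case: ifPn => // ht.
  rewrite cy// dy//; apply: out; near: t; apply: nbg.
  by apply: lt_le_trans h; lra.
- move=> s s01; rewrite /c'; rewrite ifN ?cx// -leNgt.
  apply: le_trans e1 _; move: s01; rewrite negb_and -!leNgt => /orP[] h.
    by rewrite ler_normr; apply/orP; right; lra.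
  by rewrite ler_normr; apply/orP; left; lra.
- exists (e * e').
    by rewrite mulr_gt0//=; nra.
  move=> s h; rewrite /c' ifT; last by apply: lt_le_trans h _; nra.
  by apply: dz; rewrite unorm ltr_pdivrMl.
Unshelve. all: by end_near. Qed.

End Excursions.

(** * Excursions between any two points of a connected manifold *)

Section Reachability.
Variables (R : realType) (X : topologicalType) (A : atlas_on R X).
Hypothesis hM : is_manifold A.

Lemma chart_nbhs U phi y (r : R) : m_charts A (U, phi) -> U y -> 0 < r ->
  \forall z \near y, U z /\ `|phi z - phi y| < r.
Proof.
move=> hU Uy r0; have [oU _ cphi _] := chart_is_chart hM hU.
move: cphi; rewrite continuous_open_subspace// => /(_ y).
rewrite inE => /(_ Uy) /cvgrPdist_lt cphi; near=> z; split.
  by near: z; exact: open_nbhs_nbhs.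
by rewrite distrC; near: z; exact: cphi.
Unshelve. all: by end_near. Qed.

Lemma chart_ball U phi x : m_charts A (U, phi) -> U x ->
  exists2 r : R, 0 < r & forall v, `|v - phi x| < r -> (phi @` U) v.
Proof.
move=> hU Ux; have [oU _ _ op] := chart_is_chart hM hU.
have : nbhs (phi x) (phi @` U).
  by apply: open_nbhs_nbhs; split; [exact: op|exists x].
move=> /nbhs_normP[r /= r0 h]; exists r => // v vr; apply: h.
by rewrite /= distrC.
Qed.

(** The curve follows the segment from [phi x] to [phi z], which stays in the ball by convexity. As
    the centre p is separate from x and z, one ball serves for both directions. *)
Lemma excursion_chart U phi p r x z : m_charts A (U, phi) ->
  (forall v, `|v - p| < r -> (phi @` U) v) -> U x -> U z ->
  `|phi x - p| < r -> `|phi z - p| < r ->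
  exists2 c, excursion A x z c &
    forall s, U (c s) /\ phi (c s) = phi x + plateau s *: (phi z - phi x).
Proof.
move=> hU hball Ux Uz xr zr; have [_ inj _ _] := chart_is_chart hM hU.
have /choice[c cP] (s : R) :
    exists w, U w /\ phi w = phi x + plateau s *: (phi z - phi x).
  suff /hball[w Uw <-] : `|phi x + plateau s *: (phi z - phi x) - p| < r.
    by exists w.
  have -> : phi x + plateau s *: (phi z - phi x) - p =
      (1 - plateau s) *: (phi x - p) + plateau s *: (phi z - p).
    rewrite [in RHS]scalerBl scale1r -[RHS]addrA [- _ + _]addrC -scalerBr.
    by rewrite opprB [phi z - p + _]addrA subrK addrAC.
  have b0 := @plateau_ge0 R s; have b1 := @plateau_le1 R s.
  apply: le_lt_trans (ler_normD _ _) _.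
  rewrite !normrZ !ger0_norm ?(subr_ge0 (plateau s))//.
  move: (`|_|) (`|_|) (plateau s) xr zr b0 b1 => d a b ar dr b0 b1.
  have [b_gt0|b_le0] := ltP 0 b.
    have : 0 < b * (r - d) by rewrite mulr_gt0// subr_gt0.
    have : 0 <= (1 - b) * (r - a) by rewrite mulr_ge0// subr_ge0// ltW.
    lra.
  have -> : b = 0 by apply/eqP; rewrite eq_le b_le0.
  by rewrite subr0 mul1r mul0r addr0.
exists c => //; split.
- move=> t; apply: (lsmooth_chart (B := setT) hU _ _ _ (fun y _ => cP y)) => //.
    exact: openT.
  move=> k; apply: Ck_on_add; [exact: openT|exact: Ck_on_cst|].
  by apply: Ck_on_scale; [exact: openT|exact: Ck_plateau|exact: Ck_on_cst].
- move=> t t01; have [Us cs] := cP t.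
  by apply: inj; rewrite ?inE// cs plateau_out// scale0r addr0.
- exists (1 / 4); first by apply/andP; split; lra.
  move=> t /ltW sd; have [Us cs] := cP t.
  by apply: inj; rewrite ?inE// cs plateau_in// scale1r addrC subrK.
Qed.

(** The set of points reachable from x is open and closed: nearby points reach each other inside a
    chart, and excursions concatenate. *)
Lemma connected_excursion : connected [set: X] ->
  forall x y, exists c, excursion A x y c.
Proof.
move=> conn x; pose S := [set y | exists c, excursion A x y c].
have Sx : S x.
  exists (fun=> x); split=> //; first by move=> s; exact: lsmooth_cst.
  by exists (1 / 4) => //; apply/andP; split; lra.
have near_exc y : \forall z \near y,
    (exists c, excursion A y z c) /\ (exists c, excursion A z y c).
  have [U [phi [hU Uy]]] := chart_at hM y; have [r r0 hr] := chart_ball hU Uy.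
  have yr : `|phi y - phi y| < r by rewrite subrr normr0.
  near=> z; have [Uz zr] : U z /\ `|phi z - phi y| < r.
    by near: z; exact: chart_nbhs.
  by split; [have [c ? _] := excursion_chart hU hr Uy Uz yr zr
            |have [c ? _] := excursion_chart hU hr Uz Uy zr yr]; exists c.
have oS : open S.
  rewrite openE => y [c Sy]; apply: filterS (near_exc y) => z [[d yz] _].
  exact: excursion_trans Sy yz.
have oSC : open (~` S).
  rewrite openE => y Sy; apply: filterS (near_exc y) => z [_ [d zy]] [c Sz].
  by apply: Sy; exact: excursion_trans Sz zy.
suff ST : S = setT by move=> y; have : S y by rewrite ST.
apply: conn; first by exists x.
  by exists S => //; rewrite setTI.
by exists S; [rewrite -[S]setCK; exact: open_closedC|rewrite setTI].
Unshelve. all: by end_near. Qed.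

End Reachability.

(** * Playing a sequence of curves on time slots that accumulate at 0 *)

Section Splice.
Variables (R : realType) (s : nat -> R).
Hypothesis s_gt0 : forall n, 0 < s n.
Hypothesis s_dec : forall n, 3 * s n.+1 < s n.

Lemma scale_le m n : (m <= n)%N -> s n <= s m.
Proof.
move=> /subnK <-; elim: (n - m)%N => [|k IH]; first by rewrite add0n.
rewrite addSn; apply: le_trans IH.
by have := s_gt0 (k + m).+1; have := s_dec (k + m); lra.
Qed.

Lemma scale_small e : 0 < e -> exists n, s n < e.
Proof.
(* The geometric decay is weakened to [1/(n+1)], so that the Archimedean property concludes. *)
move=> e0; have h n : s n * n.+1%:R <= s 0.
  elim: n => [|n IH]; first by rewrite mulr1.
  apply: le_trans IH; rewrite -!natr1.
  have := s_gt0 n.+1; have := s_dec n; have : 0 <= n%:R :> R by [].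
  by nra.
have := archi_boundP (ltW (divr_gt0 (s_gt0 0) e0)); set N := Num.bound _.
rewrite ltr_pdivrMr// => hN; exists N.
have := h N; rewrite -natr1; have := s_gt0 N; have : 0 <= N%:R :> R by [].
by nra.
Qed.

(** [3 * s n.+1 < s n] says exactly that slot n.+1 ends before slot n begins. *)
Definition slot n t := s n / 2 <= t <= 3 / 2 * s n.

(* h n, read in the window [0, 1], is played on slot n; d everywhere else. *)
Definition splice (Y : Type) (d : Y) (h : nat -> R -> Y) (t : R) : Y :=
  if pselect (exists n, slot n t) is left e
  then h (sval (cid e)) (t / s (sval (cid e)) - 1 / 2) else d.

Lemma slot_inj m n t : slot m t -> slot n t -> m = n.
Proof.
move=> /andP[m1 m2] /andP[n1 n2]; case: (ltngtP m n) => // mn; exfalso.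
  have := scale_le mn; have := s_dec m; have := s_gt0 n; lra.
have := scale_le mn; have := s_dec n; have := s_gt0 m; lra.
Qed.

Lemma slot_window n t : (0 <= t / s n - 1 / 2 <= 1) = slot n t.
Proof.
have sn := s_gt0 n; rewrite /slot subr_ge0 ler_pdivlMr// lerBlDr ler_pdivrMr//.
by apply/idP/idP => /andP[? ?]; apply/andP; split; lra.
Qed.

(** The slots accumulate only at 0. The witness is the least n such that slot n.+1 ends before t;
    all slots of index below n then begin after t. *)
Lemma slot_near (t : R) : 0 < t ->
  exists n, \forall u \near t, forall m, slot m u -> m = n.
Proof.
move=> t0; have ex : exists n, 3 / 2 * s n.+1 < t.
  have [|n hn] := @scale_small (t / 2); first by rewrite divr_gt0.
  by exists n; have := s_dec n; lra.
exists (ex_minn ex); case: ex_minnP => n nt nmin.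
have mt m : (m < n)%N -> t < s m / 2.
  move=> mn; rewrite ltNge; apply/negP => smt.
  have : (n <= m)%N by apply: nmin; apply: lt_le_trans smt; have := s_dec m; lra.
  by rewrite leqNgt mn.
have nu : \forall u \near t, forall m, (m < n)%N -> u < s m / 2.
  case: n nt {nmin} mt => [|n] nt mt; first by near=> u.
  near=> u; move=> m; rewrite ltnS => mn.
  apply: (@lt_le_trans _ _ (s n / 2)); last by have := scale_le mn; lra.
  by near: u; apply: lt_nbhsl; exact: mt.
near=> u; move=> m mu; have [nm|nm|//] := ltngtP m n; exfalso.
  have : u < s m / 2 by move: m nm {mu}; near: u.
  by move: mu => /andP[]; lra.
have : 3 / 2 * s n.+1 < u by near: u; exact: lt_nbhsr.
by move: mu => /andP[_]; have := scale_le nm; lra.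
Unshelve. all: by end_near. Qed.

Variables (Y : Type) (d : Y) (h : nat -> R -> Y).
Hypothesis h_out : forall n (u : R), ~~ (0 <= u <= 1) -> h n u = d.

Lemma splice_in n t : slot n t -> splice d h t = h n (t / s n - 1 / 2).
Proof.
move=> nt; rewrite /splice; case: pselect => [e|]; last by case; exists n.
by case: cid => /= m mt; rewrite (slot_inj mt nt).
Qed.

Lemma splice_out t : (forall n, ~ slot n t) -> splice d h t = d.
Proof.
move=> nt; rewrite /splice; case: pselect => // e; exfalso.
by case: e => n /nt.
Qed.

Lemma splice_le0 (t : R) : t <= 0 -> splice d h t = d.
Proof.
by move=> t0; apply: splice_out => n /andP[nt _]; have := s_gt0 n; lra.
Qed.

(** Together with [slot_near] this makes the splice, near any positive time, a single rescaled
    [h n], also across the ends of the slot. *)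
Lemma splice_eq n t : (forall m, slot m t -> m = n) ->
  splice d h t = h n (t / s n - 1 / 2).
Proof.
move=> nt; have [tn|tn] := pselect (slot n t); first exact: splice_in.
rewrite h_out; last by rewrite slot_window; exact/negP.
by apply: splice_out => m mt; apply: tn; rewrite -(nt _ mt).
Qed.

End Splice.

(** * Rapidly decreasing pulses *)

Section Pulses.
Variables (R : realType) (s : nat -> R) (W : normedModType R).
Hypothesis s_gt0 : forall n, 0 < s n.
Hypothesis s_dec : forall n, 3 * s n.+1 < s n.
Implicit Types (B : R -> R) (w : nat -> W).

Definition rapid w := forall k, exists C, forall n, `|w n| <= C * s n ^+ k.

Definition windowed B := forall u : R, ~~ (0 <= u <= 1) -> B u = 0.

(** This is the shape, in a chart, of the displacement of the spliced curve from its value at time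
    0. *)
Definition pulses B w := splice s 0 (fun n u => B u *: w n).

Lemma windowed_derive B : windowed B -> windowed ('D_1 B).
Proof.
move=> Bo u u01; rewrite (@near_eq_derive _ _ _ _ (fun=> 0)) ?derive_cst//.
move: u01; rewrite negb_and -!ltNge => /orP[u0|u1]; near=> t; apply: Bo.
  by rewrite negb_and -!ltNge; apply/orP; left; near: t; exact: lt_nbhsl.
by rewrite negb_and -!ltNge; apply/orP; right; near: t; exact: lt_nbhsr.
Unshelve. all: by end_near. Qed.

Lemma windowed_bounded B : windowed B -> Ck_on 0 setT B ->
  exists2 M, 0 <= M & forall u, `|B u| <= M.
Proof.
move=> Bo cB; have := @EVT_max R (fun u => `|B u|) 0 1 ler01.
case=> [|c _ cmax].
  apply: continuous_subspaceT => u; apply: cvg_norm; exact: cB.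
exists `|B c| => // u; have [u01|u01] := boolP (0 <= u <= 1).
  by apply: cmax; rewrite in_itv.
by rewrite Bo// normr0.
Qed.

Lemma is_derive_pulses B w t : windowed B -> Ck_on 1 setT B -> rapid w ->
  is_derive t (1 : R) (pulses B w) (pulses ('D_1 B) (fun n => (s n)^-1 *: w n) t).
Proof.
move=> Bo CB wr; have B'o := windowed_derive Bo.
have [t0|t0|t0] := ltrgtP 0 t.
- have [n nt] := slot_near s_gt0 s_dec t0.
  apply: (@near_eq_is_derive _ _ W (fun u : R => B (u / s n - 1 / 2) *: w n)).
    near=> u; rewrite /pulses (@splice_eq _ _ s_gt0 s_dec _ _ _ _ n)//.
      by move=> m v /Bo ->; rewrite scale0r.
    by near: u.
  rewrite /pulses (@splice_eq _ _ s_gt0 s_dec _ _ _ _ n); last 2 first.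
    by move=> m u /B'o ->; rewrite scale0r.
    exact: nbhs_singleton nt.
  have dB u : is_derive u (1 : R) B ('D_1 B u).
    by apply/derivableP/derivable1_diffP; have [dB _] := CB; exact: dB.
  have da : is_derive t (1 : R) (B \o (fun u => u / s n - 1 / 2))
     ('D_1 B (t / s n - 1 / 2) * (s n)^-1).
    apply: is_derive1_comp.
    have : is_derive t (1 : R) ((fun u : R => u * (s n)^-1) + (fun=> - (1 / 2)))
       ((s n)^-1 + 0).
      apply: is_deriveD.
      have -> : (fun u : R => u * (s n)^-1) = (s n)^-1 \*: (@id R).
        by apply/funext => u; rewrite /= mulrC.
      by apply: is_derive_eq; rewrite [_ *: _]mulr1.
    by rewrite addr0.
  have [da1 da2] := da.
  have [H1 H2] := is_derive_scale da1 (derivable_cst (w n) t (1 : R)).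
  split; first exact: H1.
  by rewrite H2 derive_cst scaler0 add0r da2 scalerA.
- apply: (@near_eq_is_derive _ _ _ (fun=> 0)).
    near=> u; rewrite /pulses (splice_le0 s_gt0)//; apply/ltW.
    by near: u; exact: lt_nbhsl.
  by rewrite /pulses (splice_le0 s_gt0 _ _ (ltW t0)); exact: is_derive_cst.
- rewrite -t0 [X in is_derive _ _ _ X]/pulses splice_le0//.
  have [M M0 BM] := windowed_bounded Bo (Ck_onW CB); have [C wC] := wr 2.
  (* On slot n one has [s n <= 2 u], hence [|w n| <= |C| (s n)^2 <= 4 |C| u^2]; M bounds B. *)
  apply: (@is_derive_flat _ _ _ (4 * M * `|C|)).
    by rewrite /pulses splice_le0.
  near=> u; have [[n un]|un] := pselect (exists n, slot s n u); last first.
    rewrite /pulses splice_out ?normr0; last by move=> n nu; apply: un; exists n.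
    by rewrite mulr_ge0 ?sqr_ge0// mulr_ge0// mulr_ge0.
  rewrite /pulses (splice_in s_gt0 s_dec _ _ un) normrZ.
  have {}wC : `|w n| <= `|C| * s n ^+ 2.
    by apply: le_trans (wC n) _; rewrite ler_wpM2r ?sqr_ge0// ler_norm.
  apply: le_trans (ler_pM _ _ (BM _) wC) _ => //.
  have -> : 4 * M * `|C| * u ^+ 2 = M * (`|C| * (2 * u) ^+ 2) by ring.
  apply: ler_wpM2l => //; apply: ler_wpM2l => //.
  move: un => /andP[un _]; have sn := s_gt0 n.
  by apply: lerXn2r; rewrite ?nnegrE; lra.
Unshelve. all: by end_near. Qed.

Lemma rapid_scale w : rapid w -> rapid (fun n => (s n)^-1 *: w n).
Proof.
move=> wr k; have [C wC] := wr k.+1; exists C => n; have sn := s_gt0 n.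
rewrite normrZ normfV gtr0_norm// ler_pdivrMl// mulrCA -exprS.
exact: wC.
Qed.

(** The derivative is again a pulse function, with profile ['D_1 B] and heights [w n / s n], and
    rapid decrease survives division by [s n]. *)
Lemma Ck_pulses k B w : windowed B -> smooth_on setT B -> rapid w ->
  Ck_on k setT (pulses B w).
Proof.
elim: k B w => [|k IH] B w Bo sB wr.
  move=> t _; apply/differentiable_continuous/derivable1_diffP.
  by have [] := is_derive_pulses t Bo (sB 1) wr.
apply: Ck_onS1; first exact: openT.
  by move=> t _; have [] := is_derive_pulses t Bo (sB 1) wr.
apply: (@Ck_on_ext _ _ _ _ (pulses ('D_1 B) (fun n => (s n)^-1 *: w n))).
- exact: openT.
- by move=> t _; have [_ ->] := is_derive_pulses t Bo (sB 1) wr.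
- apply: IH; [exact: windowed_derive| |exact: rapid_scale].
  by move=> j; have [_] := sB j.+1; exact.
Qed.

End Pulses.

(** * Curves through prescribed points *)

Section Special_curve.
Variables (R : realType) (s : nat -> R).
Hypothesis s_gt0 : forall n, 0 < s n.
Hypothesis s_dec : forall n, 3 * s n.+1 < s n.

(** From some index N1 on, [y n] lies in a chart ball around x and the excursion is a segment there,
    so near time 0 the curve is [phi x] plus pulses. The finitely many earlier excursions are
    arbitrary ones given by connectedness. *)
Lemma special_curve (X : topologicalType) (A : atlas_on R X) :
  is_manifold A -> connected [set: X] ->
  forall (x : X) (y : nat -> X) U phi N,
  m_charts A (U, phi) -> U x -> (forall n, (N <= n)%N -> U (y n)) ->
  (forall k, exists C, forall n, (N <= n)%N ->
     `|phi (y n) - phi x| <= C * s n ^+ k) ->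
  exists2 c, smooth_curve A c & c 0 = x /\ forall n, c (s n) = y n.
Proof.
move=> hM conn x y U phi N hU Ux Uy fast.
have [r r0 hr] := chart_ball hM hU Ux.
have [N1 N1P] : exists N1, forall n, (N1 <= n)%N ->
    (N <= n)%N /\ `|phi (y n) - phi x| < r.
  have [C hC] := fast 1; have C1 : 0 < `|C| + 1 by rewrite ltr_wpDl.
  have [N2 hN2] := scale_small s_gt0 s_dec (divr_gt0 r0 C1).
  exists (maxn N N2) => n; rewrite geq_max => /andP[Nn N2n]; split=> //.
  apply: le_lt_trans (hC n Nn) _; rewrite expr1.
  have := scale_le s_gt0 s_dec N2n; have := s_gt0 n; have := ler_norm C.
  by move: hN2; rewrite ltr_pdivlMr//; nra.
have /choice[sig sigP] n : exists c, excursion A x (y n) c /\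
    ((N1 <= n)%N -> forall t, U (c t) /\
       phi (c t) = phi x + plateau t *: (phi (y n) - phi x)).
  have [/N1P[Nn yr]|Nn] := leqP N1 n.
    have xr : `|phi x - phi x| < r by rewrite subrr normr0.
    by have [c ? ?] := excursion_chart hM hU hr Ux (Uy n Nn) xr yr; exists c.
  by have [c ?] := connected_excursion hM conn x (y n); exists c.
pose c := splice s x sig.
have sig_out n (u : R) : ~~ (0 <= u <= 1) -> sig n u = x.
  move=> u01; have [[_ + _] _] := sigP n; apply.
  by apply: contra u01 => /andP[/ltW -> /ltW ->].
pose w n := if (N1 <= n)%N then phi (y n) - phi x else 0.
have wr : rapid s w.
  move=> k; have [C hC] := fast k; exists `|C| => n.
  rewrite /w; case: ifPn => [/N1P[Nn _]|_].
    by apply: le_trans (hC n Nn) _; rewrite ler_wpM2r ?ler_norm// exprn_ge0// ltW.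
  by rewrite normr0 mulr_ge0// exprn_ge0// ltW.
have po : windowed (@plateau R).
  by move=> u u01; apply: plateau_out; apply: contra u01 => /andP[/ltW -> /ltW ->].
(* Before the beginning of slot N1 only excursions made of chart segments occur. *)
have cU t : t < s N1 / 2 ->
    U (c t) /\ phi (c t) = phi x + pulses s (@plateau R) w t.
  move=> tN; rewrite /c /pulses; have [[n nt]|nt] := pselect (exists n, slot s n t).
    rewrite !(splice_in s_gt0 s_dec _ _ nt).
    have Nn : (N1 <= n)%N.
      rewrite leqNgt; apply/negP => /ltnW /(scale_le s_gt0 s_dec).
      by move: nt => /andP[+ _]; lra.
    by have [_ /(_ Nn)] := sigP n; rewrite /w Nn; apply.
  have nt' n : ~ slot s n t by move=> ?; apply: nt; exists n.
  by rewrite !splice_out// addr0.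
exists c; last split.
- apply: lsmooth_curve => // t; have [t0|t0] := ltP 0 t.
    have [n nt] := slot_near s_gt0 s_dec t0.
    apply: (@lsmooth_near _ _ _ (sig n \o (fun u => (s n)^-1 * u + - (1 / 2)))).
      near=> u; rewrite /c (@splice_eq _ _ s_gt0 s_dec _ _ _ sig_out n).
        by rewrite /= mulrC.
      by near: u.
    apply: lsmooth_comp; first by move=> k; exact: Ck_affine.
    by have [[+ _ _] _] := sigP n; apply.
  have oB : open [set u : R | u < s N1 / 2] by exact: open_lt.
  apply: (lsmooth_chart hU oB _ _ cU) => /=.
    by apply: le_lt_trans t0 _; rewrite divr_gt0.
  move=> k; apply: (@Ck_on_sub _ _ _ _ _ setT) => //.
  apply: Ck_on_add; [exact: openT|exact: Ck_on_cst|].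
  by apply: Ck_pulses => // j; exact: Ck_plateau.
- by rewrite /c splice_le0.
- move=> n; have sn := s_gt0 n.
  have nn : slot s n (s n) by apply/andP; split; lra.
  rewrite /c (splice_in s_gt0 s_dec _ _ nn) divff ?gt_eqF//.
  have [[_ _ [e /andP[e0 _] +]] _] := sigP n; apply.
  by rewrite [X in `|X|](_ : _ = 0) ?normr0//; field.
Unshelve. all: by end_near. Qed.

End Special_curve.

(** * Structure curves in the product and sequences stationary in each coordinate *)

Section Product.
Variables (R : realType) (T : Type) (M : T -> topologicalType).
Variable A : forall t, atlas_on R (M t).
Hypothesis hM : forall t, is_manifold (A t).
Hypothesis hconn : forall t, connected [set: M t].
Variable f : prod_topology M -> R.
Hypothesis Cf : Cinf_prod A f.

Lemma special_structure_curve (s : nat -> R) (x : prod_topology M)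
    (y : nat -> prod_topology M) :
  (forall n, 0 < s n) -> (forall n, 3 * s n.+1 < s n) ->
  (forall t, exists U phi N, [/\ m_charts (A t) (U, phi), U (x t),
    forall n, (N <= n)%N -> U (y n t) &
    forall k, exists C, forall n, (N <= n)%N ->
      `|phi (y n t) - phi (x t)| <= C * s n ^+ k]) ->
  exists2 c, structure_curve A c & c 0 = x /\ forall n, c (s n) = y n.
Proof.
move=> s_gt0 s_dec h.
have H t : exists c, smooth_curve (A t) c /\
    (c 0 = x t /\ forall n, c (s n) = y n t).
  have [U [phi [N [hU Ux Uy fast]]]] := h t.
  by have [c] := special_curve s_gt0 s_dec (hM t) (@hconn t) hU Ux Uy fast; exists c.
exists (fun u t => sval (cid (H t)) u).
  by move=> t; have [] := svalP (cid (H t)).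
split=> [|n]; apply: functional_extensionality_dep => t;
  by have [_ []] := svalP (cid (H t)).
Qed.

(* Differentiability of f along a curve through the y n at the times s n gives
   |f (y n) - f x| = O(s n), whereas s may decrease arbitrarily fast. *)
Lemma coordinatewise_stationary (x : prod_topology M) (y : nat -> prod_topology M) :
  (forall t, exists N, forall n, (N <= n)%N -> y n t = x t) ->
  exists n, f (y n) = f x.
Proof.
move=> yx; apply: contrapT => fyx.
have d_gt0 n : 0 < `|f (y n) - f x|.
  by rewrite normr_gt0 subr_eq0; apply/eqP => h; apply: fyx; exists n.
pose d n := `|f (y n) - f x|.
(* The first entry of the minimum gives the geometric decay, the second makes the difference
   quotient of f at time [s n] at least [n+1] in norm. *)
pose s := fix s n := if n is m.+1 then Num.min (s m / 4) (d n / n.+1%:R) else d 0.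
have s_gt0 n : 0 < s n.
  by elim: n => [|n IH]; rewrite /= ?lt_min ?divr_gt0//; exact: d_gt0.
have s_dec n : 3 * s n.+1 < s n.
  have : s n.+1 <= s n / 4 by rewrite /= ge_min lexx.
  by have := s_gt0 n; lra.
have s_le n : s n * n.+1%:R <= d n.
  case: n => [|n]; first by rewrite mulr1.
  by rewrite -ler_pdivlMr// /= ge_min lexx orbT.
have [|c sc [c0 cs]] := @special_structure_curve s x y s_gt0 s_dec.
  move=> t; have [U [phi [hU Ux]]] := chart_at (hM t) (x t).
  have [N hN] := yx t; exists U, phi, N; split=> //.
    by move=> n /hN ->.
  by move=> k; exists 0 => n /hN ->; rewrite subrr normr0 mul0r.
have [/(_ 0 I)/derivable1_diffP/cvgrPdist_lt/(_ _ ltr01) + _] := Cf sc 1.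
set L := lim _; rewrite near_withinE => -/nbhs_ballP[e /= e0 he].
have [N hN] := scale_small s_gt0 s_dec e0.
(* At such an n the quotient would be both within 1 of the derivative L and larger than
   [|L| + 1]. *)
have [n [Nn Ln]] : exists n, (N <= n)%N /\ `|L| + 1 <= n%:R.
  have := archi_boundP (addr_ge0 (normr_ge0 L) ler01); set m := Num.bound _ => hm.
  exists (maxn N m); rewrite leq_maxl; split=> //.
  by apply: le_trans (ltW hm) _; rewrite ler_nat leq_maxr.
have sn := s_gt0 n.
have := he (s n); rewrite /ball/= sub0r normrN gtr0_norm// => /(_ _ _).
rewrite addr0 [s n *: 1]mulr1 c0 cs => h.
have {h} : `|L - (s n)^-1 *: (f (y n) - f x)| < 1.
  apply: h; last by rewrite gt_eqF.
  by apply: le_lt_trans hN; exact: scale_le.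
have := s_le n; have -> : d n = s n * `|(s n)^-1 *: (f (y n) - f x)|.
  by rewrite normrZ normfV gtr0_norm// mulrA divff ?mul1r// gt_eqF.
set q := _ *: _; rewrite ler_pM2l// -natr1 => nq Lq.
have : `|q| <= `|L| + `|L - q|.
  by have -> : q = L - (L - q); [rewrite subKr|rewrite {2}subKr ler_normB].
by lra.
Qed.

End Product.

(** * Functions stationary along coordinatewise stationary sequences *)

Lemma decreasing_stationary (T : Type) (D : nat -> set T) :
  (forall n, D n.+1 `<=` D n) ->
  forall t, exists N, forall n, (N <= n)%N ->
    (t \in D n) = (t \in \bigcap_k D k).
Proof.
move=> dec t; have mono m n : (m <= n)%N -> D n `<=` D m.
  move=> /subnK <-; elim: (n - m)%N => [|k IH]; first by rewrite add0n.
  by rewrite addSn; exact: subset_trans (dec _) IH.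
have [tD|tD] := pselect ((\bigcap_k D k) t).
  by exists 0%N => n _; rewrite !mem_set//; exact: tD.
have /existsNP[N tN] : ~ forall k, D k t by move=> h; apply: tD => k _; exact: h.
exists N => n Nn; rewrite !memNset// => /(mono _ _ Nn); exact: tN.
Qed.

Section Stationary_functions.
Variables (T : Type) (M : T -> Type) (Y : Type) (f : (forall t, M t) -> Y).
Implicit Types (x y : forall t, M t) (B F : set T).
Hypothesis f_stat : forall x (y : nat -> forall t, M t),
  (forall t, exists N, forall n, (N <= n)%N -> y n t = x t) ->
  exists n, f (y n) = f x.

Definition mix x y B : forall t, M t := fun t => if t \in B then y t else x t.

(** Through this, what holds of f at every [mix x y (D n)] passes to the limit set B. *)
Lemma mix_stationary x y (D : nat -> set T) B :
  (forall t, exists N, forall n, (N <= n)%N -> (t \in D n) = (t \in B)) ->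
  exists n, f (mix x y (D n)) = f (mix x y B).
Proof.
move=> DB; apply: (f_stat (y := fun n => mix x y (D n))) => t.
by have [N hN] := DB t; exists N => n /hN h; rewrite /mix h.
Qed.

Variable e : T -> nat -> bool.
Hypothesis e_inj : injective e.

(* Bisection along the digits of e: the cell C shrinks to at most one point while
   replacing y by x on C keeps changing the value of f to c. *)
Lemma critical_point x y c A F : F `<=` A ->
  f (mix x y A) <> c -> f (mix x y F) = c ->
  exists B t, [/\ F `<=` B, B `<=` A, B t /\ ~ F t,
    f (mix x y B) <> c & f (mix x y (B `\ t)) = c].
Proof.
move=> FA fA fF.
(* A state is the current set and the current cell; removing the cell from the set gives the value
   c, the set itself does not. If removing the half with digit true already gives c, that half
   becomes the cell; otherwise it is discarded from the set and the other half becomes the cell. *)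
pose step n (p : set T * set T) :=
  let C1 := p.2 `&` [set t | e t n] in
  if pselect (f (mix x y (p.1 `\` C1)) = c) then (p.1, C1)
  else (p.1 `\` C1, p.2 `\` [set t | e t n]).
pose p := fix p n := if n is m.+1 then step m (p m) else (A, ~` F).
have inv n : f (mix x y (p n).1) <> c /\ f (mix x y ((p n).1 `\` (p n).2)) = c.
  elim: n => [|n [IH1 IH2]] /=.
    by split=> //; rewrite setDE setCK setIidr.
  rewrite /step; case: pselect => //= h; split=> //.
  by rewrite setDDl setUIDK.
have dec1 n : (p n.+1).1 `<=` (p n).1.
  by rewrite /= /step; case: pselect => /= _ t; [|case].
have dec2 n : (p n.+1).2 `<=` (p n).2.
  by rewrite /= /step; case: pselect => /= _ t [].
have pF n : F `<=` (p n).1 /\ (p n).2 `<=` ~` F.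
  elim: n => [|n [IH1 IH2]]; first by split.
  split; last exact: subset_trans (dec2 n) IH2.
  rewrite /= /step; case: pselect => /= _ t Ft; first exact: IH1.
  split; first exact: IH1.
  by move=> [/IH2].
have same n t t' : (p n.+1).2 t -> (p n.+1).2 t' -> e t n = e t' n.
  rewrite /= /step; case: pselect => //= _ [_ ht] [_ ht']; first by rewrite ht ht'.
  by move/negP/negbTE: ht => ->; move/negP/negbTE: ht' => ->.
pose B := \bigcap_n (p n).1; pose C := \bigcap_n (p n).2.
have statB := decreasing_stationary dec1.
have statC := decreasing_stationary dec2.
have fB : f (mix x y B) <> c.
  have [n <-] := mix_stationary x y statB; by have [] := inv n.
have fBC : f (mix x y (B `\` C)) = c.
  have [t|n <-] := @mix_stationary x y (fun n => (p n).1 `\` (p n).2) (B `\` C).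
    have [N1 h1] := statB t; have [N2 h2] := statC t.
    exists (maxn N1 N2) => n; rewrite geq_max => /andP[/h1 n1 /h2 n2].
    by rewrite !in_setD n1 n2.
  by have [] := inv n.
have [[t [Bt Ct]]|noBC] := pselect (exists t, B t /\ C t); last first.
  exfalso; apply: fB; rewrite -fBC; congr (f (mix x y _)).
  apply/seteqP; split=> t => [Bt|[]//].
  by split=> // Ct; apply: noBC; exists t.
have Ct1 : C = [set t].
  apply/seteqP; split=> [t' Ct'|_ ->//]; apply: e_inj; apply/funext => n.
  by apply: same; [exact: Ct'|exact: Ct].
exists B, t; split=> //.
- by move=> t' Ft' n _; have [h _] := pF n; exact: h.
- by move=> t' /(_ 0%N I).
- by split=> //; have [_ h] := pF 0%N; apply: h; exact: Ct.
- by rewrite -Ct1.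
Qed.

(* Otherwise critical_point yields a decreasing sequence B n and distinct points t n,
   all belonging to every B m, such that removing t n from B n.+1 restores the
   value f x; but B n.+1 and B n.+1 `\ t n have the same limit. *)
Lemma finite_mix x y A : f (mix x y A) <> f x ->
  exists2 F, finite_set F & f (mix x y F) <> f x.
Proof.
move=> fA; apply: contrapT => noF.
have fF F : finite_set F -> f (mix x y F) = f x.
  by move=> finF; apply: contrapT => h; apply: noF; exists F.
pose inv (p : set T * set T) :=
  [/\ finite_set p.2, p.2 `<=` p.1 & f (mix x y p.1) <> f x].
have /choice[g gP] (p : {p | inv p}) : exists q : {p | inv p} * T,
    [/\ (sval q.1).1 `<=` (sval p).1, (sval q.1).2 = (sval p).2 `|` [set q.2],
      ~ (sval p).2 q.2 & f (mix x y ((sval q.1).1 `\ q.2)) = f x].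
  case: p => -[B F] /= [finF FB fB].
  have [B' [t [FB' B'B [B't Ft] fB' fB't]]] := critical_point FB fB (fF _ finF).
  have i' : inv (B', F `|` [set t]).
    split=> //=; first by rewrite finite_setU; split=> //; exact: finite_set1.
    by move=> u [/FB'|->].
  by exists (exist _ _ i', t).
have i0 : inv (A, set0) by split=> //; exact: finite_set0.
pose p := fix p n := if n is m.+1 then (g (p m)).1 else exist _ _ i0.
pose t n := (g (p n)).2; pose B n := (sval (p n)).1; pose F n := (sval (p n)).2.
have decB n : B n.+1 `<=` B n by have [] := gP (p n).
have Fmono m n : (m <= n)%N -> F m `<=` F n.
  move=> /subnK <-; elim: (n - m)%N => [|k IH]; first by rewrite add0n.
  rewrite addSn /F /=; have [_ -> _ _] := gP (p (k + m)%N).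
  by move=> u Fu; left; exact: IH.
have t_inj m n : (m < n)%N -> t m <> t n.
  move=> mn tmn; have [_ _ + _] := gP (p n); apply; rewrite -/(t n) -tmn.
  by apply: (Fmono _ _ mn); rewrite /F /=; have [_ -> _ _] := gP (p m); right.
have statB := decreasing_stationary decB.
have [n fBn] := mix_stationary x y statB.
have [u|m] := @mix_stationary x y (fun n => B n.+1 `\ t n) (\bigcap_n B n).
  have [N1 h1] := statB u.
  (* A coordinate u is some [t m] at most once, so removing [t n] does not affect it for large n. *)
  have [N2 h2] : exists N2, forall n, (N2 <= n)%N -> u <> t n.
    have [[m ->]|h] := pselect (exists m, u = t m).
      by exists m.+1 => k mk; exact: t_inj.
    by exists 0%N => k _ uk; apply: h; exists k.
  exists (maxn N1 N2) => k; rewrite geq_max => /andP[k1 k2].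
  have tk : (u \in [set t k]) = false by apply: memNset; exact: h2.
  by rewrite in_setD tk andbT h1// (leq_trans k1).
rewrite -fBn; have [_ _ _ ->] := gP (p m).
by have [_ _ h] := svalP (p n) => /esym.
Qed.

(* Otherwise one finds y_n agreeing with x on F_n and off F_(n+1), for finite F_n
   increasing with n, and f (y_n) <> f x. *)
Lemma finitely_determined x : exists2 F, finite_set F &
  forall y, (forall t, F t -> y t = x t) -> f y = f x.
Proof.
apply: contrapT => noF.
have /choice[g gP] (F : {F : set T | finite_set F}) :
    exists q : (forall t, M t) * {F : set T | finite_set F},
    [/\ sval F `<=` sval q.2, forall t, sval F t -> q.1 t = x t,
      forall t, ~ sval q.2 t -> q.1 t = x t & f q.1 <> f x].
  case: F => F finF /=.
  have [y /not_implyP[yF fy]] :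
      exists y, ~ ((forall t, F t -> y t = x t) -> f y = f x).
    by apply/existsNP => h; apply: noF; exists F.
  have [|G finG fG] := @finite_mix x y setT.
    suff -> : mix x y setT = y by [].
    by apply: functional_extensionality_dep => t; rewrite /mix in_setT.
  have finFG : finite_set (F `|` G) by rewrite finite_setU.
  exists (mix x y G, exist _ _ finFG); split=> //=.
  - by move=> t /yF; rewrite /mix; case: ifP.
  - by move=> t FGt; rewrite /mix memNset// => Gt; apply: FGt; right.
pose F0 := exist _ _ (@finite_set0 T).
pose F := fix F n := if n is m.+1 then (g (F m)).2 else F0.
pose y n := (g (F n)).1.
have Fmono m n : (m <= n)%N -> sval (F m) `<=` sval (F n).
  move=> /subnK <-; elim: (n - m)%N => [|k IH]; first by rewrite add0n.
  by rewrite addSn; have [h _ _ _] := gP (F (k + m)%N); exact: subset_trans IH h.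
have [t|n] := @f_stat x y.
  have [[m Ft]|nF] := pselect (exists m, sval (F m) t).
    exists m => n mn; have [_ h _ _] := gP (F n).
    by apply: h; exact: Fmono mn _ Ft.
  exists 0%N => n _; have [_ _ h _] := gP (F n); apply: h => Ft.
  by apply: nF; exists n.+1.
by have [_ _ _ h] := gP (F n).
Qed.

End Stationary_functions.

(** * The product topology *)

Section Product_topology.
Variables (T : Type) (M : T -> topologicalType).
Implicit Types (x z : prod_topology M).

(** Finite subsets of an arbitrary type are enumerated by lists over [{classic T}]; repeated entries
    are skipped. *)
Lemma finite_set_seq_ind (P : set T -> Prop) : P set0 ->
  (forall t G, finite_set G -> ~ G t -> P G -> P (t |` G)) ->
  forall G, finite_set G -> P G.
Proof.
move=> P0 PU G /(@finite_seqP {classic T})[s ->]; elim: s => [|t s IH].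
  by rewrite (_ : [set` _] = set0)//; apply/seteqP; split.
rewrite (_ : [set` _] = t |` [set` s]); last first.
  apply/seteqP; split=> u /=; rewrite inE.
    by case/predU1P; [left|right].
  by case=> [->|us]; rewrite ?eqxx// us orbT.
have [ts|ts] := pselect ([set` s] t); last first.
  by apply: PU => //; apply/(@finite_seqP {classic T}); exists s.
by rewrite (_ : t |` _ = [set` s])//; apply/seteqP; split=> u; [case=> // ->|right].
Qed.

Lemma prod_nbhs_box x (G : set T) (O : forall t, set (M t)) : finite_set G ->
  (forall t, G t -> nbhs (x t) (O t)) ->
  nbhs x [set z : prod_topology M | forall t, G t -> O t (z t)].
Proof.
move=> finG; move: G finG; apply: finite_set_seq_ind => [_|t G _ _ IH xO].
  by apply: filterE => z t [].
have h1 : nbhs x [set z : prod_topology M | O t (z t)].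
  by apply: (@proj_continuous {classic T} M t x); apply: xO; left.
have h2 := IH (fun u Gu => xO u (or_intror Gu)).
by apply: filterS (filterI h1 h2) => z [zt zG] u [->|]; [exact: zt|exact: zG].
Qed.

(** The sets containing a finite box around x form a filter. The product topology is a supremum of
    initial topologies, so convergence of this filter to x is checked one projection at a time. *)
Lemma prod_nbhs_basis x (N : set (prod_topology M)) : nbhs x N ->
  exists (G : set T) (O : forall t, set (M t)), [/\ finite_set G,
    forall t, nbhs (x t) (O t) & forall z, (forall t, G t -> O t (z t)) -> N z].
Proof.
pose F : set_system (prod_topology M) := [set N | exists (G : set T)
  (O : forall t, set (M t)), [/\ finite_set G,
    forall t, nbhs (x t) (O t) & forall z, (forall t, G t -> O t (z t)) -> N z]].
have FF : Filter F.
  split.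
  - exists set0, (fun=> setT); split=> // t; exact: filterT.
  - move=> P Q [G [V [finG xO GP]]] [G' [V' [finG' xO' GQ]]].
    exists (G `|` G'), (fun t => V t `&` V' t); split.
    + by rewrite finite_setU.
    + by move=> t; exact: filterI.
    + move=> z h; split; [apply: GP|apply: GQ] => t Gt.
        by have [] := h t (or_introl Gt).
      by have [] := h t (or_intror Gt).
  - move=> P Q PQ [G [V [finG xO GP]]]; exists G, V; split=> // z h.
    by apply: PQ; exact: GP.
suff : F --> x by exact.
apply/cvg_sup => t U [V [[W oW <-] WxV WU]].
exists [set t], (@dfwith {classic T} (fun t => set (M t)) (fun=> setT) t W).
split; first exact: finite_set1.
- move=> u; have [<-|tu] := @eqVneq {classic T} t u.
    by rewrite dfwithin; exact: open_nbhs_nbhs.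
  by rewrite dfwithout//; exact: filterT.
- by move=> z /(_ t erefl); rewrite dfwithin => Wz; apply: WU.
Qed.

Lemma dense_sequence (X : topologicalType) (x0 : X) : @second_countable X ->
  exists d : nat -> X, forall (x : X) O, nbhs x O -> exists n, O (d n).
Proof.
move=> [B /countable_injP[i i_inj] [oB xB]].
exists (fun n => xget x0 [set x : X | exists2 V, B V /\ i V = n & V x]) => x O xO.
have [V [BV Vx] VO] := xB x _ xO; exists (i V).
have [W [BW iW] Wy] := @xgetPex _ x0 [set x : X | exists2 W, B W /\ i W = i V & W x]
  (ex_intro _ x (ex_intro2 _ _ V (conj BV erefl) Vx)).
have WV : W = V by apply: i_inj; rewrite ?inE.
by apply: VO; rewrite WV in Wy.
Qed.

Variable e : T -> nat -> bool.
Hypothesis e_inj : injective e.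

(* A countable dense family in a product over a set of size at most the continuum:
   a point is prescribed on finitely many cylinders of the Cantor space. *)
Fixpoint lookup (k : seq (seq bool * nat)) (a : nat -> bool) : nat :=
  if k is (p, n) :: k' then if p == mkseq a (size p) then n else lookup k' a
  else 0.

Lemma separating_prefix (G : set T) t : finite_set G -> ~ G t ->
  exists m, forall u, G u -> mkseq (e t) m <> mkseq (e u) m.
Proof.
move=> finG; move: G finG; apply: finite_set_seq_ind => [_|v G _ _ IH Gt].
  by exists 0%N.
have [m mP] := IH (fun Gu => Gt (or_intror Gu)).
have /existsNP[i ei] : ~ forall i, e t i = e v i.
  by move=> h; apply: Gt; left; apply: e_inj; apply/funext.
(* A prefix of length [i.+1] is the shortest that contains digit i. *)
exists (maxn m i.+1) => u [->|Gu] h.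
  apply: ei; have := congr1 (fun s => nth false s i) h.
  by rewrite !nth_mkseq// leq_maxr.
apply: (mP u Gu); have := congr1 (take m) h.
by rewrite /mkseq -!map_take !take_iota (minn_idPl (leq_maxl _ _)).
Qed.

(** Induction on G: the entry put in front for a new t uses a prefix shared with no older
    coordinate, so older lookups are unchanged. There are only countably many lists k. *)
Lemma dense_points (d : forall t, nat -> M t) (G : set T)
    (O : forall t, set (M t)) :
  finite_set G -> (forall t, exists n, O t (d t n)) ->
  exists k, forall t, G t -> O t (d t (lookup k (e t))).
Proof.
move=> finG dO; move: G finG; apply: finite_set_seq_ind => [|t G finG Gt [k kP]].
  by exists [::].
have [m mP] := separating_prefix finG Gt; have [n tn] := dO t.
exists ((mkseq (e t) m, n) :: k) => u [->|Gu] /=; rewrite size_mkseq.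
  by rewrite eqxx.
by case: eqP => [/(mP u Gu)|_] //; exact: kP.
Qed.

End Product_topology.

(** * Continuity for the product topology *)

Section Continuity.
Variables (R : realType) (T : Type) (M : T -> topologicalType).
Variable A : forall t, atlas_on R (M t).
Hypothesis hM : forall t, is_manifold (A t).
Hypothesis hconn : forall t, connected [set: M t].
Variable f : prod_topology M -> R.
Hypothesis Cf : Cinf_prod A f.
Hypothesis f_det : forall x : prod_topology M, exists2 F, finite_set F &
  forall y : prod_topology M, (forall t, F t -> y t = x t) -> f y = f x.

Lemma Cinf_prod_continuous : continuous f.
Proof.
move=> x; apply: contrapT => ncf.
have [eps eps0 far] : exists2 eps : R, 0 < eps & forall N : set (prod_topology M),
    nbhs x N -> exists2 y, N y & eps <= `|f x - f y|.
  apply: contrapT => h; apply: ncf.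
  apply/(@cvgrPdist_lt _ _ _ (nbhs x) (nbhs_filter x)) => eps eps0.
  apply: contrapT => nh; apply: h; exists eps => // N xN.
  apply: contrapT => noy; apply: nh; apply: filterS xN => y Ny.
  by rewrite ltNge; apply/negP => h; apply: noy; exists y.
pose s n : R := 4^-1 ^+ n.
have s_gt0 n : 0 < s n by rewrite exprn_gt0// invr_gt0.
have s_dec n : 3 * s n.+1 < s n.
  by rewrite /s exprS mulrA gtr_pMl ?s_gt0//; lra.
have chart t : exists c : set (M t) * (M t -> 'rV[R]_(mdim (A t))),
    m_charts (A t) c /\ c.1 (x t).
  by have [U [phi [? ?]]] := chart_at (hM t) (x t); exists (U, phi).
pose U t := (sval (cid (chart t))).1; pose phi t := (sval (cid (chart t))).2.
have hU t : m_charts (A t) (U t, phi t).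
  by rewrite /U /phi -surjective_pairing; have [] := svalP (cid (chart t)).
have Ux t : U t (x t) by have [] := svalP (cid (chart t)).
(* The n-th bad point is within [s n ^ n] of x on the finite set F. It is reset to x off a larger
   finite set containing one that determines f there, which leaves its f-value alone. *)
have /choice[g gP] (p : nat * {F : set T | finite_set F}) :
    exists q : prod_topology M * {F : set T | finite_set F},
    [/\ sval p.2 `<=` sval q.2, forall t, ~ sval q.2 t -> q.1 t = x t,
      forall t, sval p.2 t -> U t (q.1 t) /\
        `|phi t (q.1 t) - phi t (x t)| < s p.1 ^+ p.1 &
      eps <= `|f x - f q.1|].
  case: p => n [F finF] /=.
  have [y yF fy] := far _ (prod_nbhs_box (x := x) finF (fun t _ =>
    chart_nbhs (hM t) (hU t) (Ux t) (exprn_gt0 n (s_gt0 n)))).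
  have [G finG yG] := f_det y.
  have finFG : finite_set (F `|` G) by rewrite finite_setU.
  exists ((mix x y (F `|` G) : prod_topology M), exist _ _ finFG); split=> /=.
  - by move=> t; left.
  - by move=> t tFG; rewrite /mix memNset.
  - by move=> t Ft; rewrite /mix mem_set; [exact: yF|left].
  - by rewrite (yG (mix _ _ _)) => // t Gt; rewrite /mix mem_set//; right.
pose F0 := exist _ _ (@finite_set0 T).
pose F := fix F n := if n is m.+1 then (g (m, F m)).2 else F0.
pose y n := (g (n, F n)).1.
have Fmono m n : (m <= n)%N -> sval (F m) `<=` sval (F n).
  move=> /subnK <-; elim: (n - m)%N => [|k IH]; first by rewrite add0n.
  rewrite addSn; have [h _ _ _] := gP ((k + m)%N, F (k + m)%N).
  exact: subset_trans IH h.
have [t|c sc [c0 cs]] :=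
  special_structure_curve hM hconn (x := x) (y := y) s_gt0 s_dec.
  exists (U t), (phi t); have [[m Fm]|nF] := pselect (exists m, sval (F m) t).
    exists m.
    have fast n : (m <= n)%N -> U t (y n t) /\
        `|phi t (y n t) - phi t (x t)| < s n ^+ n.
      by move=> mn; have [_ _ h _] := gP (n, F n); apply: h; exact: Fmono Fm.
    split=> //; first by move=> n /fast[].
    (* In exponents of 1/4 the bound [s n ^ n <= s n ^ k / s k ^ k] reads [n k <= k^2 + n^2]. *)
    move=> k; exists (s k ^+ k)^-1 => n /fast[_ /ltW h]; apply: le_trans h _.
    rewrite ler_pdivlMl ?exprn_gt0// /s -!exprM -exprD.
    apply: ler_wiXn2l; [by rewrite invr_ge0|by rewrite invf_le1//; lra|].
    by case/orP: (leq_total n k) => h; [apply: leq_trans (leq_addr _ _)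
      |apply: leq_trans (leq_addl _ _)]; rewrite leq_mul.
  have yx n : y n t = x t.
    have [_ h _ _] := gP (n, F n); apply: h => Ft; apply: nF; by exists n.+1.
  exists 0%N; split=> //; first by move=> n _; rewrite yx.
  by move=> k; exists 0 => n _; rewrite yx subrr normr0 mul0r.
have : (f \o c) @ (0 : R) --> (f \o c) 0 by apply: (Cf sc 0).
move=> /cvgrPdist_lt/(_ _ eps0)/nbhs_ballP[d /= d0 hd].
have [n hn] := scale_small s_gt0 s_dec d0.
have := hd (s n); rewrite /ball/= sub0r normrN gtr0_norm// => /(_ hn).
rewrite c0 cs ltNge => /negP; apply.
by have [_ _ _ h] := gP (n, F n).
Qed.

End Continuity.

(** * Dependence on countably many coordinates *)

Section Cylindricity.
Variables (R : realType) (T : Type) (M : T -> topologicalType).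
Variable f : prod_topology M -> R.
Hypothesis f_cont : continuous f.
Hypothesis f_det : forall x : prod_topology M, exists2 F, finite_set F &
  forall y : prod_topology M, (forall t, F t -> y t = x t) -> f y = f x.
Variable e : T -> nat -> bool.
Hypothesis e_inj : injective e.
Hypothesis M_sc : forall t, @second_countable (M t).
Variable p : prod_topology M.

(* T0 collects the finite sets determining f at the points d of a countable
   dense set. Overwriting d by y' off T0 does not change f d, while if y = y' on T0 it turns
   approximations of y into approximations of y'. *)
Lemma countably_determined : exists2 T0 : set T, countable T0 &
  forall y y' : prod_topology M, (forall t, T0 t -> y t = y' t) -> f y = f y'.
Proof.
pose d t := sval (cid (dense_sequence (p t) (M_sc t))).
have dP t (x : M t) O : nbhs x O -> exists n, O (d t n).
  exact: (svalP (cid (dense_sequence (p t) (M_sc t)))).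
pose pt k : prod_topology M := fun t => d t (lookup k (e t)).
pose F x := sval (cid2 (f_det x)).
have finF x : finite_set (F x) by rewrite /F; case: cid2.
have FP x (y : prod_topology M) : (forall t, F x t -> y t = x t) -> f y = f x.
  by rewrite /F; case: cid2 => /= G _; apply.
pose T0 := \bigcup_(k in [set: seq (seq bool * nat)]) F (pt k).
exists T0; first by apply: bigcup_countable => // k _; exact: finite_set_countable.
move=> y y' yy'; apply/eqP; rewrite -subr_eq0 -normr_le0.
apply/ler_addgt0Pr => eps eps0.
have near_f x : nbhs x [set z | `|f x - f z| < eps / 2].
  have [+] := @cvgrPdist_lt _ _ _ (nbhs x) (nbhs_filter x) f (f x).
  by move=> /(_ (@f_cont x) _ (divr_gt0 eps0 (ltr0Sn _ 1))).
have [G [V [finG yO GN]]] := prod_nbhs_basis (near_f y).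
have [G' [V' [finG' yO' GN']]] := prod_nbhs_basis (near_f y').
(* On T0 the approximating point must meet the boxes of both y and y', which is possible as
   [y t = y' t] there. *)
pose O2 t := V t `&` [set v | T0 t -> V' t v].
have [|t|k kP] := dense_points e_inj (d := d) (G := G `|` G') (O := O2).
- by rewrite finite_setU.
- apply: (dP _ (y t)); apply: filterI => //.
  have [T0t|T0t] := pselect (T0 t); last by apply: filterE => v.
  by rewrite yy'//; apply: filterS (yO' t) => v ? _.
have h1 : `|f y - f (pt k)| < eps / 2.
  by apply: GN => t Gt; have [] := kP t (or_introl Gt).
have h2 : `|f y' - f (pt k)| < eps / 2.
  rewrite -(FP (pt k) (mix y' (pt k) T0)).
    apply: GN' => t Gt; rewrite /mix; case: ifPn => [/set_mem T0t|_].
      by have [_ /(_ T0t)] := kP t (or_intror Gt).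
    exact: nbhs_singleton (yO' t).
  by move=> t Ft; rewrite /mix mem_set//; exists k.
rewrite add0r; have -> : f y - f y' = (f y - f (pt k)) - (f y' - f (pt k)).
  by rewrite opprB addrA subrK.
by apply: le_trans (ler_normB _ _) _; lra.
Qed.

End Cylindricity.

Unset Implicit Arguments.

Theorem theorem11 (R : realType) (T : Type)
    (M : T -> topologicalType) (A : forall t, atlas_on R (M t))
    (hM : forall t, is_manifold (A t))
    (hconn : forall t, connected [set: M t])
    (hcard : exists e : T -> (nat -> bool), injective e)
    (f : prod_topology M -> R) :
  Cinf_prod A f ->
  continuous f /\
  exists T0 : set T, countable T0 /\
    exists fT0 : prod_topology (restr_fam T0 M) -> R,
      Cinf_prod (restr_atlas T0 A) fT0 /\ f = fT0 \o proj_sub T0.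
Proof.
move=> Cf; have [e e_inj] := hcard.
have f_stat := coordinatewise_stationary hM hconn Cf.
have f_det := finitely_determined f_stat e_inj.
have cf := Cinf_prod_continuous hM hconn Cf f_det; split=> //.
(* If some factor is empty, so are the product and its projection to that factor, and everything
   holds vacuously. Otherwise a base point p exists. *)
have [[t0 M0]|M_inh] := pselect (exists t, ~ exists x : M t, True).
  have absurd (x : M t0) : False by apply: M0; exists x.
  exists [set t0]; split; first exact/finite_set_countable/finite_set1.
  exists (fun=> 0); split; last by apply/funext => x; case: (absurd (x t0)).
  by move=> c _; case: (absurd (c 0 (exist _ t0 erefl))).
have inh t : exists x : M t, True by apply: contrapT => h; apply: M_inh; exists t.
pose p : prod_topology M := fun t => sval (cid (inh t)).
have M_sc t : @second_countable (M t) by have [] := hM t.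
have [T0 T0c T0P] := countably_determined cf f_det e_inj M_sc p.
(* Filling in p off T0 sends structure curves to structure curves, the added components being
   constant. *)
pose ext (w : prod_topology (restr_fam T0 M)) : prod_topology M :=
  fun t => if pselect (T0 t) is left h then w (exist _ t h) else p t.
exists T0; split=> //; exists (f \o ext); split; last first.
  apply/funext => x; apply: T0P => t T0t.
  by rewrite /ext; case: pselect.
move=> c sc; apply: (Cf (ext \o c)) => t; rewrite /ext /=.
case: pselect => [h|_]; first exact: (sc (exist _ t h)).
by apply: lsmooth_curve => // u; exact: lsmooth_cst.
Qed.
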